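(* Let $(\Omega,\mathcal A,\mathbb P)$ be a probability space. For all $p\in(1,+\infty)$ and $c>1$, with $q=p/(p-1)$, it holds that $$\rho_{p,c}(X)=\rho_{R_{q,c}}(X)\qquad\text{for each }X\in\mathbb L^p(\Omega,\mathbb R).$$
   Context: The higher moment risk measure is $\rho_{p,c}(X)=\inf_{t\in\mathbb R}\big\{t+c\,\mathbb E[(X-t)_+^p]^{1/p}\big\}$, where $a_+=\max\{a,0\}$. With $\mathbb R_+=[0,+\infty)$, $R_{q,c}$ is the set of Borel probability measures $r$ on $\mathbb R_+$ such that $\int_{\mathbb R_+}y\,\mathrm dr(y)=1$ and $\int_{\mathbb R_+}y^q\,\mathrm dr(y)\le c^q$. For a set $R$ of Borel probability measures on $\mathbb R$ with uniformly bounded $q$-th moments, $\rho_R(X)=\chi_R(\mathbb P_X)$ where $\mathbb P_X$ is the law of $X$ and $\chi_R(m)=\sup_{\pi\in\Pi(m,R)}\int_{\mathbb R^2}xy\,\mathrm d\pi(x,y)$, with $\Pi(m,R)$ the set of Borel probability measures on $\mathbb R^2$ with first marginal $m$ and second marginal in $R$. *)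

(* Defs.v *)
From HB Require Import structures.
From mathcomp Require Import all_boot all_order all_algebra.
From mathcomp Require Import all_classical all_reals all_analysis.

Set Implicit Arguments.
Unset Strict Implicit.
Unset Printing Implicit Defensive.

Import Order.TTheory GRing.Theory Num.Theory.

Local Open Scope classical_set_scope.
Local Open Scope ring_scope.
Local Open Scope ereal_scope.

Definition higher_moment_risk (R : realType) (d : measure_display)
    (T : measurableType d) (P : probability T R) (p c : R) (X : T -> R) :
    \bar R :=
  ereal_inf [set t%:E + c%:E *
    ('E_P[fun w => ((Num.max (X w - t) 0) `^ p)%R]) `^ p^-1 | t in [set: R]].

(* Borel probability measures on R_+ are represented by Borel probability
   measures on R that are concentrated on R_+. *)
Definition moment_ball (R : realType) (q c : R) : set (probability R R) :=
  [set r : probability R R |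
    [/\ r `[0%R, +oo[%classic = 1,
        \int[r]_(y in `[0%R, +oo[) y%:E = 1 &
        \int[r]_(y in `[0%R, +oo[) (y `^ q)%:E <= (c `^ q)%:E]].

(* A measure is a function on all subsets, whose values are constrained only on
   measurable ones, so marginals are compared on measurable sets. *)
Definition couplings (R : realType) (m : probability R R)
    (S : set (probability R R)) : set (probability (R * R)%type R) :=
  [set pi |
    (forall A, measurable A -> pushforward pi fst A = m A) /\
    exists2 r, S r & forall A, measurable A -> pushforward pi snd A = r A].

Definition max_correlation (R : realType) (S : set (probability R R))
    (m : probability R R) : \bar R :=
  ereal_sup [set \int[pi]_z (z.1 * z.2)%:E | pi in couplings m S].

Definition max_correlation_risk (R : realType) (d : measure_display)
    (T : measurableType d) (P : probability T R)
    (S : set (probability R R)) (X : {RV P >-> R}) : \bar R :=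
  max_correlation S (distribution P X).

(* Main.v *)
Require Import Defs.
From HB Require Import structures.
From mathcomp Require Import all_boot all_order all_algebra.
From mathcomp Require Import all_classical all_reals all_analysis.
From mathcomp Require Import measurable_realfun lebesgue_integral_under.
From mathcomp Require Import ring lra.

Set Implicit Arguments.
Unset Strict Implicit.
Unset Printing Implicit Defensive.

Import Order.TTheory GRing.Theory Num.Theory.
Import numFieldNormedType.Exports.

Local Open Scope classical_set_scope.
Local Open Scope ring_scope.
Local Open Scope ereal_scope.

(** The identity is the Lagrange duality between the constraint that Y has mean
    one and the shift t, and both values are attained.

    Weak duality ([weak_duality], [max_correlation_risk_le]): if Y >= 0 has mean
    one and norm at most c in L^q, then for every t
      E[XY] = t + E[(X - t) Y] <= t + E[(X - t)_+ Y]
            <= t + c E[(X - t)_+^p]^(1/p)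
    by Hoelder. A coupling of the law of X with a member of the moment ball is
    such a pair (X, Y) on the plane, so the argument is run on that space.

    Attainment ([exists_optimal_density]): it suffices to find t and a
    feasible Y for which these are equalities; the law of (X, Y) is then an
    optimal coupling ([dual_feasible_le_risk]). On any probability space Y can
    be found among the functions of X. Write A_s(t) = E[(X - t)_+^s].
    Equality in Hoelder suggests Y = (X - t)_+^(p-1) / A_(p-1)(t), which
    has norm c in L^q exactly when c A_(p-1)(t) = A_p(t)^((p-1)/p); this is
    also the first-order condition for t ([power_density_optimal]).

    Such a t exists as soon as c A_(p-1)(t) <= A_p(t)^((p-1)/p) for some t below
    the essential supremum ([upper_moment_crossing]): the family
    (1 + h (X - t - 1))_+ is constant 1 at h = 0, where the reverse strict
    inequality c > 1 holds, and is (X - t)_+ at h = 1, so the intermediate value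
    theorem gives equality at some h > 0; rescaling by h turns that member of
    the family into a positive part of X minus a constant.

    Otherwise Hoelder on the event X > t shows that each nonzero tail
    probability P(X > t) is at least c^(-p) ([ccdf_lower_bound]). Hence X is
    bounded above and its essential supremum M is an atom of mass at least
    c^(-p) ([ccdf_gap_atom]); the normalized indicator of X >= M is
    feasible, and both sides equal M at t = M ([endpoint_density_optimal]). *)

(** * Truncated powers and their moments *)

Lemma continuous_max0_powR (R : realType) (s : R) : (0 < s)%R ->
  continuous (fun x : R => (Num.max x 0) `^ s)%R.
Proof.
move=> s0 x; have [x0|x0] := ltP 0%R x.
- apply: (@cvg_trans _ ((fun y : R => expR (s * ln y)) @ x)).
    apply: near_eq_cvg; near=> y.
    have y0 : (0 < y)%R by near: y; exact: lt_nbhsr.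
    by rewrite (max_idPl _) ?(ltW y0)// /powR gt_eqF.
  rewrite (max_idPl _) ?(ltW x0)// /powR gt_eqF//.
  apply: (@continuous_cvg _ _ _ (nbhs x) _ (fun y => s * ln y)%R (@expR R)).
    exact: continuous_expR.
  by apply: cvgMl_tmp; exact: continuous_ln.
- rewrite /continuous_at (max_idPr x0)// powR0 ?gt_eqF//.
  apply/cvgrPdist_lt => e e0.
  have es0 : (0 < e `^ s^-1)%R by exact: powR_gt0.
  near=> y.
  rewrite sub0r normrN ger0_norm ?powR_ge0//.
  rewrite [ltRHS](_ : e = (e `^ s^-1) `^ s)%R; last first.
    by rewrite -powRrM mulVf ?gt_eqF// powRr1// ltW.
  apply: gt0_ltr_powR => //; rewrite ?nnegrE ?le_max ?lexx ?orbT ?(ltW es0)//.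
  rewrite gt_max es0 andbT; near: y.
  by apply: lt_nbhsl; exact: le_lt_trans x0 es0.
Unshelve. all: by end_near. Qed.

(** The bound is uniform in a and b in [-K, K]: it provides both the
    integrability of the truncated powers and the dominating function in
    [continuous_moment]. *)
Lemma max0_affine_powR_le (R : realType) (p s K a b x : R) :
  (0 <= s <= p)%R -> (1 <= K)%R -> (`|a| <= K)%R -> (`|b| <= K)%R ->
  ((Num.max (a * x + b) 0) `^ s <= (2 * K) `^ p * (`|x| `^ p + 1))%R.
Proof.
move=> /andP[s0 sp] K1 aK bK; pose m := Num.max `|x|%R 1%R.
have m1 : (1 <= m)%R by rewrite le_max lexx orbT.
have xm : (`|x| <= m)%R by rewrite le_max lexx.
have p0 : (0 <= p)%R := le_trans s0 sp.
have Km : (K <= K * m)%R by rewrite ler_peMr// (le_trans ler01).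
have Km1 : (1 <= K * m)%R := le_trans K1 Km.
have base : (Num.max (a * x + b) 0 <= 2 * K * m)%R.
  rewrite ge_max; apply/andP; split; last by rewrite -mulrA; lra.
  rewrite (le_trans (ler_norm _))// (le_trans (ler_normD _ _))// normrM.
  have : (`|a| * `|x| <= K * m)%R by exact: ler_pM.
  by move: (le_trans bK Km); lra.
have m0 : (0 <= Num.max (a * x + b) 0)%R by rewrite le_max lexx orbT.
apply: (@le_trans _ _ ((2 * K * m) `^ s)%R).
  by apply: ge0_ler_powR => //; rewrite nnegrE// (le_trans m0).
apply: (@le_trans _ _ ((2 * K * m) `^ p)%R).
  by apply: ler_powR => //; rewrite -mulrA; lra.
rewrite powRM; [|lra|lra]; apply: ler_wpM2l; first exact: powR_ge0.
have := powR_ge0 `|x|%R p.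
by rewrite /m; case: (leP `|x| 1)%R => _; rewrite ?powR1 /=; lra.
Qed.

Section moments.
Context d (T : measurableType d) (R : realType) (P : probability T R) (p : R).
Hypothesis p1 : (1 < p)%R.
Variable X : T -> R.
Hypothesis Xp : X \in Lfun P p%:E.

Lemma Lfun_measurable : measurable_fun [set: T] X.
Proof. by move: Xp; rewrite inE => /andP[/[!inE]]. Qed.

Lemma measurable_max0_powR (f : T -> R) s : measurable_fun [set: T] f ->
  measurable_fun [set: T] (fun w => (Num.max (f w) 0) `^ s)%R.
Proof.
move=> mf; apply: (measurableT_comp (measurable_powR _)).
by apply: measurable_maxr => //; exact: measurable_cst.
Qed.

Lemma integrable_Lfun_bound (K : R) :
  P.-integrable [set: T] (EFin \o (fun w => K * (`|X w| `^ p + 1)))%R.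
Proof.
rewrite (_ : _ \o _ = fun w => K%:E * ((`|X w| `^ p)%:E + 1))//.
apply: integrableZl => //; apply: integrableD => //.
  exact: (Lfun_integrable (ltW p1)).
exact: finite_measure_integrable_cst.
Qed.

Lemma integrable_max0_powR (s a b : R) : (0 <= s <= p)%R ->
  P.-integrable [set: T] (EFin \o (fun w => (Num.max (a * X w + b) 0) `^ s))%R.
Proof.
move=> sp; pose K := (1 + `|a| + `|b|)%R.
have a0 := normr_ge0 a; have b0 := normr_ge0 b.
apply: (le_integrable measurableT _ _ (integrable_Lfun_bound ((2 * K) `^ p)%R)).
  apply/measurable_EFinP/measurable_max0_powR.
  by apply: measurable_funD => //; apply: measurable_funM => //; exact: Lfun_measurable.
move=> w _ /=; rewrite lee_fin ger0_norm ?powR_ge0// ger0_norm; last first.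
  by rewrite mulr_ge0 ?addr_ge0 ?powR_ge0.
by apply: max0_affine_powR_le => //; rewrite /K; lra.
Qed.

(** The family is parametrized so that its member at h = 0 is constant;
    [upper_moment_crossing] applies the intermediate value theorem along it. *)
Lemma continuous_moment (s t : R) : (0 < s <= p)%R ->
  {within `[0%R, 1%R], continuous
    (fun h : R => \int[P]_w (Num.max (1 + h * (X w - t)) 0) `^ s)%R}.
Proof.
move=> /andP[s0 sp].
have s0p : (0 <= s <= p)%R by rewrite ltW.
have E h w : (1 + h * (X w - t) = h * X w + (1 - h * t))%R by ring.
apply: continuous_in_subspaceT => h hI.
pose K := (2 + 2 * `|t|)%R.
have t0 := normr_ge0 t.
(* The open interval ]-1, 2[ is only a neighborhood of [0, 1] on which the
   coefficients stay bounded by K. *)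
apply: (@continuity_under_integral R _ T P
  (fun h w => (Num.max (1 + h * (X w - t)) 0) `^ s)%R setT measurableT (-1) 2
  _ _ _ (integrable_Lfun_bound ((2 * K) `^ p)%R)).
- move=> k _; rewrite (_ : _ \o _ = EFin \o
    (fun w => (Num.max (k * X w + (1 - k * t)) 0) `^ s)%R).
    exact: integrable_max0_powR.
  by apply/funext => w; rewrite /= E.
- apply: nearW => w _ k _.
  apply: (@continuous_cvg _ _ _ (nbhs k) _ (fun h => 1 + h * (X w - t))%R
    (fun x : R => (Num.max x 0) `^ s)%R); first exact: continuous_max0_powR.
  apply: cvgD; first exact: cvg_cst.
  by apply: cvgMr_tmp; exact: cvg_id.
- move=> k; rewrite /= in_itv/= => /andP[k1 k2]; apply: nearW => w _.
  rewrite ger0_norm ?powR_ge0// E.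
  have k3 : (`|k| <= 2)%R by rewrite ler_norml; lra.
  apply: max0_affine_powR_le => //; rewrite ?/K; [lra|lra|].
  rewrite (le_trans (ler_normB _ _))// normr1 normrM.
  by have : (`|k| * `|t| <= 2 * `|t|)%R by [exact: ler_wpM2r]; lra.
- rewrite inE/=; move: hI; rewrite inE/= !in_itv/= => /andP[h1 h2].
  by apply/andP; split; lra.
Qed.

End moments.

(** * Weak duality *)

(** A random variable satisfying these conditions has its law in the moment
    ball; working with random variables rather than laws lets Hoelder's
    inequality be used on any space that carries the coupling. *)
Definition dual_feasible d (T : measurableType d) (R : realType)
    (P : probability T R) (q c : R) (Y : T -> R) :=
  [/\ measurable_fun [set: T] Y, (forall w, 0 <= Y w)%R,
      \int[P]_w (Y w)%:E = 1 & \int[P]_w (Y w `^ q)%:E <= (c `^ q)%:E].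

Section weak_duality.
Context d (T : measurableType d) (R : realType) (P : probability T R).
Variables p q c : R.
Hypotheses (p1 : (1 < p)%R) (hq : q = (p / (p - 1))%R).

Lemma conjugate_gt0 : (0 < q)%R.
Proof. by rewrite hq divr_gt0 ?subr_gt0// (lt_trans ltr01 p1). Qed.

Lemma conjugate_inv : (q^-1 = (p - 1) / p)%R.
Proof. by rewrite hq invf_div. Qed.

Lemma conjugateD : (p^-1 + q^-1 = 1)%R.
Proof.
rewrite conjugate_inv; have p0 : (p != 0)%R by rewrite gt_eqF// (lt_trans ltr01 p1).
by field.
Qed.

Lemma hoelder_ge0 (f g : T -> R) (a b : R) :
  (0 < a)%R -> (0 < b)%R -> (a^-1 + b^-1 = 1)%R ->
  measurable_fun [set: T] f -> measurable_fun [set: T] g ->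
  (forall w, 0 <= f w)%R -> (forall w, 0 <= g w)%R ->
  \int[P]_w (f w * g w)%:E <=
    (\int[P]_w (f w `^ a)%:E) `^ a^-1 * (\int[P]_w (g w `^ b)%:E) `^ b^-1.
Proof.
move=> a0 b0 ab mf mg f0 g0; have := hoelder P mf mg a0 b0 ab.
rewrite Lnorm1 unlock/=.
under eq_integral do rewrite ger0_norm ?mulr_ge0//.
have E (h : T -> R) r : (forall w, 0 <= h w)%R ->
    \int[P]_w (`|h w| `^ r)%:E = \int[P]_w (h w `^ r)%:E.
  by move=> h0; apply: eq_integral => w _; rewrite ger0_norm.
by rewrite !E.
Qed.

Variables X Y : T -> R.
Hypotheses (Xp : X \in Lfun P p%:E) (FY : dual_feasible P q c Y).

Lemma integrable_dual_feasible : P.-integrable [set: T] (EFin \o Y).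
Proof.
case: FY => mY Y0 Y1 _; apply/integrableP; split; first exact/measurable_EFinP.
by under eq_integral do rewrite /= ger0_norm//; rewrite Y1 ltry.
Qed.

Lemma integrable_mul_dual_feasible :
  P.-integrable [set: T] (EFin \o (X \* Y)%R).
Proof.
have mX := Lfun_measurable Xp; case: FY => mY Y0 _ Yq.
apply/integrableP; split; first exact/measurable_EFinP/measurable_funM.
have := hoelder P mX mY (lt_trans ltr01 p1) conjugate_gt0 conjugateD.
rewrite Lnorm1 => /le_lt_trans; apply.
apply: lte_mul_pinfty; first exact: Lnorm_ge0.
  rewrite ge0_fin_numE ?Lnorm_ge0//.
  by move: Xp; rewrite inE => /andP[_ /[!inE]].
rewrite unlock poweR_lty// (le_lt_trans _ (ltry (c `^ q)%R))//.
rewrite (le_trans _ Yq)//.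
by under eq_integral do rewrite /= ger0_norm//.
Qed.

(** Since Y has mean one, E[XY] - t is E[(X - t) Y]; bounding X - t by its
    positive part is allowed as Y >= 0, and it leaves a product of nonnegative
    functions, to which Hoelder's inequality applies. *)
Lemma weak_duality t : (0 <= c)%R ->
  \int[P]_w (X w * Y w)%:E <=
    t%:E + c%:E * ('E_P[fun w => ((Num.max (X w - t) 0) `^ p)%R]) `^ p^-1.
Proof.
move=> c0; have mX := Lfun_measurable Xp; case: (FY) => mY Y0 Y1 Yq.
have q0 := conjugate_gt0.
have p0 := lt_trans ltr01 p1.
pose Z w := Num.max (X w - t)%R 0%R.
have mZ : measurable_fun [set: T] Z.
  apply: measurable_maxr; last exact: measurable_cst.
  by apply: measurable_funB => //; exact: measurable_cst.
have Z0 w : (0 <= Z w)%R by rewrite /Z le_max lexx orbT.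
have EZ0 : 0 <= \int[P]_w (Z w `^ p)%:E.
  by apply: integral_ge0 => w _; rewrite lee_fin powR_ge0.
have EY0 : 0 <= \int[P]_w (Y w `^ q)%:E.
  by apply: integral_ge0 => w _; rewrite lee_fin powR_ge0.
have tY : P.-integrable [set: T] (fun w => t%:E * (Y w)%:E).
  by apply: integrableZl => //; exact: integrable_dual_feasible.
have XtY : P.-integrable [set: T] (fun w => (X w * Y w)%:E - t%:E * (Y w)%:E).
  by apply: integrableB => //; exact: integrable_mul_dual_feasible.
have -> : \int[P]_w (X w * Y w)%:E =
    t%:E + \int[P]_w ((X w * Y w)%:E - t%:E * (Y w)%:E).
  rewrite integralB//; last exact: integrable_mul_dual_feasible.
  rewrite integralZl//; last exact: integrable_dual_feasible.
  by rewrite Y1 mule1 [RHS]addeC subeK.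
apply: leeD2l.
apply: (@le_trans _ _ (\int[P]_w (Z w * Y w)%:E)).
  apply: le_integral => //; last first.
    move=> w _; rewrite -EFinM -EFinB lee_fin -mulrBl ler_wpM2r//.
    by rewrite le_max lexx.
  apply: (le_integrable measurableT _ _ (integrable_abse XtY)).
    exact/measurable_EFinP/measurable_funM.
  move=> w _ /=. rewrite -mulrBl lee_fin normr_id !normrM.
  rewrite ler_wpM2r// ger0_norm// ge_max normr_ge0 andbT.
  exact: ler_norm.
apply: (le_trans (hoelder_ge0 p0 q0 conjugateD mZ mY Z0 Y0)).
rewrite unlock muleC; apply: lee_wpmul2r; first exact: poweR_ge0.
rewrite (_ : c%:E = (c `^ q)%:E `^ q^-1); last first.
  by rewrite poweR_EFin -powRrM mulfV ?gt_eqF// powRr1.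
apply: gt0_ler_poweR; rewrite ?in_itv/= ?leey ?andbT//.
- by rewrite invr_ge0 ltW.
- by rewrite lee_fin powR_ge0.
Qed.

End weak_duality.

(** * Couplings and feasible random variables *)

Section couplings.
Context d (T : measurableType d) (R : realType) (P : probability T R).
Variables p q c : R.
Hypotheses (p1 : (1 < p)%R) (hq : q = (p / (p - 1))%R) (c0 : (0 <= c)%R).
Variable X : {RV P >-> R}.
Hypothesis Xp : (X : T -> R) \in Lfun P p%:E.

(** The law of (X, Y) is a coupling of the law of X with a member of the moment
    ball, and its correlation integral is E[XY]. *)
Lemma dual_feasible_le_risk (Y : T -> R) : dual_feasible P q c Y ->
  \int[P]_w (X w * Y w)%:E <= max_correlation_risk (moment_ball q c) X.
Proof.
move=> FY; have [mY Y0 Y1 Yq] := FY.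
have mXY : measurable_fun [set: T] (fun w => (X w, Y w)).
  exact: measurable_fun_pair.
pose Y' : {mfun T >-> R} := HB.pack Y (isMeasurableFun.Build _ _ _ _ _ mY).
pose XY : {mfun T >-> (R * R)%type} :=
  HB.pack (fun w => (X w, Y w)) (isMeasurableFun.Build _ _ _ _ _ mXY).
have Ypre : Y' @^-1` `[0%R, +oo[ = [set: T].
  by apply/seteqP; split => // w _; rewrite /= in_itv/= andbT.
apply: ereal_sup_ubound; exists (distribution P XY).
  split; first by move=> A mA.
  exists (distribution P Y'); last by move=> A mA.
  split.
  - by rewrite -(@probability_setT _ _ _ P) -Ypre.
  - rewrite ge0_integral_pushforward//.
    + by rewrite Ypre.
    + by move=> y /[!inE]/=; rewrite in_itv/= andbT lee_fin.
  - rewrite ge0_integral_pushforward//.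
    + by rewrite Ypre.
    + by apply/measurable_EFinP/measurable_funTS; exact: measurable_powR.
    + by move=> y _; rewrite lee_fin powR_ge0.
rewrite integral_distribution//=.
  by apply/measurable_EFinP; apply: measurable_funM.
exact: (integrable_mul_dual_feasible p1 hq Xp FY).
Qed.

(** The two coordinates of a coupling are random variables on the plane, to
    which [weak_duality] applies. The second one is nonnegative only almost
    surely, hence its replacement by the positive part V. *)
Lemma max_correlation_risk_le :
  max_correlation_risk (moment_ball q c) X <= higher_moment_risk P p c X.
Proof.
apply: ge_ereal_sup => _ [pi [piX [r [r1 ry rq] piY]] <-].
apply: le_ereal_inf_tmp => _ [t _ <-].
have p0 := lt_trans ltr01 p1.
have m1 : measurable_fun [set: R * R] fst by exact: measurable_fst.
have m2 : measurable_fun [set: R * R] snd by exact: measurable_snd.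
pose U (z : R * R) := z.1.
have mU : measurable_fun [set: R * R] U by exact: m1.
pose V (z : R * R) := Num.max z.2 0%R.
have mV2 : measurable_fun [set: R] (fun y : R => Num.max y 0%R).
  by apply: measurable_maxr => //; exact: measurable_cst.
have mV : measurable_fun [set: R * R] V.
  by exact: (measurableT_comp mV2 m2).
pose F1 : {mfun (R * R)%type >-> R} :=
  HB.pack (@fst R R) (isMeasurableFun.Build _ _ _ _ _ m1).
pose F2 : {mfun (R * R)%type >-> R} :=
  HB.pack (@snd R R) (isMeasurableFun.Build _ _ _ _ _ m2).
have intU (f : R -> \bar R) : measurable_fun [set: R] f -> (forall x, 0 <= f x) ->
    \int[pi]_z f z.1 = \int[P]_w f (X w).
  move=> mf f0; rewrite -[RHS](ge0_integral_distribution X mf)//.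
  rewrite (eq_measure_integral (distribution pi F1)) => [|A mA _]; last exact/esym/piX.
  by rewrite ge0_integral_distribution.
have rN : r (~` `[0%R, +oo[) = 0.
  by rewrite probability_setC// r1 subee.
have intV (f : R -> \bar R) : measurable_fun [set: R] f -> (forall x, 0 <= f x) ->
    \int[pi]_z f (V z) = \int[r]_(y in `[0%R, +oo[) f y.
  move=> mf f0.
  have mfV : measurable_fun [set: R] (fun y => f (Num.max y 0%R)).
    exact: measurableT_comp.
  transitivity (\int[r]_y f (Num.max y 0%R)).
    rewrite (eq_measure_integral (distribution pi F2)) => [|A mA _]; last exact/esym/piY.
    by rewrite ge0_integral_distribution.
  rewrite (@ge0_negligible_integral _ _ _ r setT (~` `[0%R, +oo[))//; last first.
    exact: measurableC.
  rewrite setTD setCK; apply: eq_integral => y; rewrite inE/= in_itv/= andbT => y0.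
  by rewrite (max_idPl _).
have piN : pi (snd @^-1` (~` `[0%R, +oo[)) = 0.
  by rewrite -rN -piY//; exact: measurableC.
have -> : \int[pi]_z (z.1 * z.2)%:E = \int[pi]_z (U z * V z)%:E.
  apply: ae_eq_integral => //.
  - exact/measurable_EFinP/measurable_funM.
  - exact/measurable_EFinP/measurable_funM.
  - exists (snd @^-1` (~` `[0%R, +oo[)); split => //.
      by rewrite -[X in measurable X]setTI; exact: (m2 measurableT _ (measurableC _)).
    move=> z /= + z0; apply => _; rewrite /V (max_idPl _)//.
    by move: z0; rewrite in_itv/= andbT.
have mabsp (s : R) : measurable_fun [set: R] (fun x : R => ((`|x| `^ s)%R)%:E).
  apply/measurable_EFinP/(measurableT_comp (measurable_powR _)).
  exact: normr_measurable.
have Up : U \in Lfun pi p%:E.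
  rewrite inE; apply/andP; split; rewrite inE//= /finite_norm unlock.
  rewrite poweR_lty//= (intU (fun x => ((`|x| `^ p)%R)%:E))//.
  have /integrableP[_] := Lfun_integrable (ltW p1) Xp.
  by under eq_integral do rewrite /= ger0_norm ?powR_ge0//.
have FV : dual_feasible pi q c V.
  split => //.
  - by move=> z; rewrite /V le_max lexx orbT.
  - transitivity (\int[pi]_z (fun y : R => (Num.max y 0%R)%:E) (V z)).
      by apply: eq_integral => z _; rewrite /V -maxA maxxx.
    rewrite (intV (fun y : R => (Num.max y 0%R)%:E)).
    + rewrite -ry; apply: eq_integral => y; rewrite inE/= in_itv/= andbT => y0.
      by rewrite (max_idPl _).
    + exact/measurable_EFinP.
    + by move=> y; rewrite lee_fin le_max lexx orbT.
  - rewrite (intV (fun y : R => ((y `^ q)%R)%:E))//.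
    + by apply/measurable_EFinP; exact: measurable_powR.
    + by move=> x; rewrite lee_fin powR_ge0.
apply: (le_trans (weak_duality p1 hq Up FV t c0)).
apply: leeD2l; rewrite !unlock.
rewrite (intU (fun x => ((Num.max (x - t) 0 `^ p)%R)%:E))//.
- apply/measurable_EFinP/measurable_max0_powR.
  by apply: measurable_funB => //; exact: measurable_cst.
- by move=> x; rewrite lee_fin powR_ge0.
Qed.

End couplings.

(** * Attainment by a truncated power *)

Definition upper_moment d (T : measurableType d) (R : realType)
    (P : probability T R) (X : T -> R) (s t : R) : R :=
  (\int[P]_w (Num.max (X w - t) 0) `^ s)%R.

Section attainment.
Context d (T : measurableType d) (R : realType) (P : probability T R).
Variables p q c : R.
Hypotheses (p1 : (1 < p)%R) (hq : q = (p / (p - 1))%R) (c1 : (1 < c)%R).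
Variable X : T -> R.
Hypothesis Xp : X \in Lfun P p%:E.

Local Notation A := (upper_moment P X).

Lemma integrable_upper_moment s t : (0 <= s <= p)%R ->
  P.-integrable [set: T] (EFin \o (fun w => (Num.max (X w - t) 0) `^ s))%R.
Proof.
move=> sp; have := integrable_max0_powR p1 Xp 1%R (- t)%R sp.
by under eq_fun do rewrite mul1r.
Qed.

Lemma upper_momentE s t : (0 <= s <= p)%R ->
  \int[P]_w ((Num.max (X w - t) 0) `^ s)%:E = (A s t)%:E.
Proof.
move=> sp; rewrite /A /Rintegral fineK//.
by apply: integrable_fin_num => //; exact: integrable_upper_moment.
Qed.

Lemma upper_moment_ge0 s t : (0 <= A s t)%R.
Proof. by apply: Rintegral_ge0 => w _; exact: powR_ge0. Qed.

Let p0 : (0 < p)%R. Proof. exact: lt_trans ltr01 p1. Qed.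
Let pB1 : (0 < p - 1)%R. Proof. by rewrite subr_gt0. Qed.
Let pB1p : (0 <= p - 1 <= p)%R. Proof. by rewrite ltW//= gerBl. Qed.
Let pp : (0 <= p <= p)%R. Proof. by rewrite ltW/=. Qed.

(** Y = (X - t)_+^(p-1) / A_(p-1)(t) is the equality case of Hoelder's
    inequality for (X - t)_+, and it vanishes where X <= t, so both inequalities
    of weak duality become equalities. The assumed equation is what makes the
    norm of Y in L^q equal to c. *)
Lemma power_density_optimal t : (0 < A (p - 1) t)%R ->
  (c * A (p - 1) t = A p t `^ ((p - 1) / p))%R ->
  exists2 Y : T -> R, dual_feasible P q c Y &
    \int[P]_w (X w * Y w)%:E =
      t%:E + c%:E * ('E_P[fun w => ((Num.max (X w - t) 0) `^ p)%R]) `^ p^-1.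
Proof.
set a := A (p - 1) t; set b := A p t => a0 cab.
have q0 : (0 < q)%R by exact: conjugate_gt0 p1 hq.
have c0 : (0 < c)%R by exact: lt_trans ltr01 c1.
have b0 : (0 <= b)%R by exact: upper_moment_ge0.
have mX := Lfun_measurable Xp.
pose Z w := Num.max (X w - t)%R 0%R.
have mZ s : measurable_fun [set: T] (fun w => (Z w `^ s)%R).
  apply: measurable_max0_powR.
  by apply: measurable_funB => //; exact: measurable_cst.
pose Y w := (a^-1 * Z w `^ (p - 1))%R.
have Yint : P.-integrable [set: T] (EFin \o Y).
  rewrite (_ : _ \o _ = fun w => (a^-1)%:E * (Z w `^ (p - 1))%:E)//.
  by apply: integrableZl => //; exact: integrable_upper_moment.
have EY : \int[P]_w (Y w)%:E = 1.
  under eq_integral do rewrite EFinM.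
  rewrite integralZl//; last exact: integrable_upper_moment.
  by rewrite upper_momentE// -EFinM mulVf// gt_eqF.
exists Y.
  split => //.
  - by apply: measurable_funM => //; exact: measurable_cst.
  - by move=> w; rewrite mulr_ge0 ?powR_ge0// invr_ge0 ltW.
  - have YqE w : (Y w `^ q = a^-1 `^ q * Z w `^ p)%R.
      rewrite powRM ?powR_ge0 ?invr_ge0 ?ltW// -powRrM; congr (_ * _ `^ _)%R.
      by rewrite hq mulrC divfK// gt_eqF.
    under eq_integral do rewrite YqE EFinM.
    rewrite integralZl//; last exact: integrable_upper_moment.
    rewrite upper_momentE// -EFinM lee_fin -/b.
    have -> : (b = (c * a) `^ q)%R.
      rewrite cab -powRrM hq [X in (_ `^ X)%R](_ : _ = 1%R) ?powRr1//.
      by field; rewrite !gt_eqF.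
    by rewrite -powRM ?invr_ge0 ?mulr_ge0 ?(ltW a0) ?(ltW c0)// mulrC mulfK// gt_eqF.
have XYE w : (X w * Y w = a^-1 * Z w `^ p + t * Y w)%R.
  rewrite /Y -(@mulr_powRB1 _ (Z w) p)//; last by rewrite le_max lexx orbT.
  rewrite /Z; case: (leP (X w - t) 0)%R => Xt.
    by rewrite powR0 ?gt_eqF//; ring.
  by ring.
under eq_integral do rewrite XYE EFinD !EFinM.
rewrite integralD//; last 2 first.
- by apply: integrableZl => //; exact: integrable_upper_moment.
- exact: integrableZl.
rewrite integralZl//; last exact: integrable_upper_moment.
rewrite integralZl// EY mule1 addeC unlock !upper_momentE//; congr (_ + _).
rewrite poweR_EFin -!EFinM -/b; congr EFin.
apply: (mulfI (lt0r_neq0 a0)); rewrite mulrA mulfV ?gt_eqF// mul1r.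
rewrite mulrCA mulrA cab -powRD; last first.
  by rewrite [X in X == _](_ : _ = 1%R) ?oner_eq0//; field; rewrite gt_eqF.
by rewrite [X in (_ `^ X)%R](_ : _ = 1%R) ?powRr1//; field; rewrite gt_eqF.
Qed.

(** The intermediate value theorem is applied to H h = c M_(p-1) - M_p^((p-1)/p),
    where M_s h is the s-th moment of (1 + h (X - t - 1))_+. At a zero h > 0 this
    variable is h (X - u)_+ with u = t + 1 - 1/h, and H is homogeneous of degree
    p - 1 under scaling, so the equation passes to u. As h <= 1, u <= t, which
    keeps the moments at u positive. *)
Lemma upper_moment_crossing t : (0 < A (p - 1) t)%R ->
  (c * A (p - 1) t <= A p t `^ ((p - 1) / p))%R ->
  exists2 u, (0 < A (p - 1) u)%R &
    (c * A (p - 1) u = A p u `^ ((p - 1) / p))%R.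
Proof.
move=> At cA.
pose M s h := (\int[P]_w (Num.max (1 + h * (X w - (t + 1))) 0) `^ s)%R.
pose H h := (c * M (p - 1) h - M p h `^ ((p - 1) / p))%R.
have M0 s h : (0 <= M s h)%R by apply: Rintegral_ge0 => w _; exact: powR_ge0.
have r0 : (0 < (p - 1) / p)%R by rewrite divr_gt0.
have cH : {within `[0%R, 1%R], continuous H}.
  move=> h; apply: cvgB.
    by apply: cvgMl_tmp; apply: (continuous_moment p1 Xp); rewrite pB1 gerBl ler01.
  (* Powers with a positive exponent are continuous on the nonnegative reals
     only, so the moment is written as a positive part. *)
  have -> : M p = fun k => Num.max (M p k) 0%R.
    by apply/funext => k; rewrite (max_idPl _).
  apply: (@continuous_cvg _ _ _ _ _ (M p)
    (fun x : R => (Num.max x 0) `^ ((p - 1) / p))%R).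
    exact: continuous_max0_powR.
  by apply: (continuous_moment p1 Xp); rewrite p0 lexx.
have Ms0 s : M s 0%R = 1%R.
  rewrite /M; under eq_Rintegral do rewrite mul0r addr0 (max_idPl ler01) powR1.
  rewrite Rintegral_cst// mul1r; have := @probability_setT _ _ _ P.
  by move=> /(congr1 fine).
have H0 : (0 < H 0)%R by rewrite /H !Ms0 powR1 mulr1 subr_gt0.
have H1 : (H 1 <= 0)%R.
  have E s : M s 1%R = A s t.
    by apply: eq_Rintegral => w _; congr (Num.max _ _ `^ _)%R; ring.
  by rewrite /H !E subr_le0.
have [|h] := @IVT _ H 0 1 0 ler01 cH.
  apply/andP; split; first by rewrite ge_min; apply/orP; right.
  by rewrite le_max; apply/orP; left; exact: ltW.
rewrite in_itv/= => /andP[h0 h1] Hh.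
have {}h0 : (0 < h)%R.
  rewrite lt_neqAle h0 andbT; apply/eqP => h0'.
  by move: Hh H0; rewrite -h0' => ->; rewrite ltxx.
pose u := (t + 1 - h^-1)%R.
have Mu s : (0 <= s <= p)%R -> M s h = (h `^ s * A s u)%R.
  move=> sp; rewrite /A -RintegralZl//; last exact: integrable_upper_moment.
  apply: eq_Rintegral => w _; rewrite -powRM ?(ltW h0) ?le_max ?lexx ?orbT//.
  congr (_ `^ _)%R; rewrite maxr_pMr ?(ltW h0)// mulr0; congr (Num.max _ _).
  by rewrite /u; field; rewrite gt_eqF.
exists u.
  apply: (lt_le_trans At); apply: le_Rintegral => //.
  - exact: integrable_upper_moment.
  - exact: integrable_upper_moment.
  - move=> w _; apply: (ge0_ler_powR (ltW pB1)).
    + by rewrite nnegrE le_max lexx orbT.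
    + by rewrite nnegrE le_max lexx orbT.
    + rewrite ge_max !le_max lexx orbT andbT; apply/orP; left.
      by rewrite lerB// /u lerBlDr lerD2l invf_ge1.
move/eqP: Hh; rewrite /H subr_eq0 !Mu// powRM ?powR_ge0 ?upper_moment_ge0//.
rewrite -powRrM [(p * _)%R]mulrC divfK ?(gt_eqF p0)// mulrCA => /eqP.
by apply: mulfI; rewrite gt_eqF// powR_gt0.
Qed.

End attainment.

(** * Attainment at an atom at the essential supremum *)

Section essential_supremum.
Context d (T : measurableType d) (R : realType) (P : probability T R).
Variable X : {RV P >-> R}.

(** M is the essential supremum of X: the supremum of the levels with a nonzero
    tail. It is finite because the tails tend to 0, hence eventually drop below
    the gap e. Right continuity makes the tail at M zero, since otherwise a level
    above M would have a nonzero tail; and P(X >= M) is the limit of the tails at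
    levels increasing to M, each of which is at least e. *)
Lemma ccdf_gap_atom (e : R) : (0 < e)%R ->
  (forall t, 0 < ccdf X t -> e%:E <= ccdf X t) ->
  exists2 M, ccdf X M = 0 & e%:E <= distribution P X `[M, +oo[.
Proof.
move=> e0 gap.
pose S := [set t | 0 < ccdf X t].
have [a Sa] : exists a, S a.
  have : \forall t \near -oo%R, 0 < ccdf X t.
    exact: (cvg_ccdfNy1 X (open_ereal_gt' lte01)).
  by move=> /filter_ex.
have [b Nb] : exists b, ccdf X b < e%:E.
  have e0' : 0 < e%:E by rewrite lte_fin.
  have : \forall t \near +oo%R, ccdf X t < e%:E.
    exact: (cvg_ccdfy0 X (open_ereal_lt' e0')).
  by move=> /filter_ex.
have ubS : ubound S b.
  move=> t St; rewrite leNgt; apply/negP => bt.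
  have := le_lt_trans (ccdf_nonincreasing X (ltW bt)) Nb.
  by rewrite ltNge gap.
have supS : has_sup S by split; [exists a|exists b].
exists (sup S).
  apply/eqP; rewrite eq_le measure_ge0 andbT leNgt; apply/negP => M0.
  have near_pos : \forall s \near (sup S)^'+, 0 < ccdf X s.
    exact: (@ccdf_right_continuous _ _ _ P X (sup S) _ (open_ereal_gt' M0)).
  have [s [Ss]] : exists s, S s /\ (sup S < s)%R.
    apply: (@filter_ex _ ((sup S)^'+)).
    by apply: filterI => //; exact: nbhs_right_gt.
  by rewrite ltNge ub_le_sup//; case: supS.
pose F n : set R := `](sup S - n.+1%:R^-1)%R, +oo[%classic.
have mF n : measurable (F n) by exact: measurable_itv.
have FE : \bigcap_n F n = `[sup S, +oo[%classic.
  apply/seteqP; split => y; last first.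
    rewrite /= in_itv/= andbT => Sy n _; rewrite /F/= in_itv/= andbT.
    by rewrite (lt_le_trans _ Sy)// ltrBlDr ltrDl invr_gt0.
  move=> Fy; rewrite /= in_itv/= andbT leNgt; apply/negP => /ltr_add_invr[n yn].
  have := Fy n I; rewrite /F/= in_itv/= andbT ltNge => /negP; apply.
  by rewrite lerBrDr ltW.
have cvF : distribution P X \o F @ \oo --> distribution P X (\bigcap_n F n).
  apply: nonincreasing_cvg_mu => //.
  - apply: le_lt_trans (ltry 1).
    exact: (@probability_le1 _ _ _ (distribution P X : probability _ _)).
  - by rewrite FE.
  - move=> m n mn; apply/subsetPset => y; rewrite /F/= !in_itv/= !andbT.
    by apply: le_lt_trans; rewrite lerB// lef_pV2 ?posrE// ler_nat ltnS.
rewrite -FE; apply: (cvge_ge _ cvF).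
apply: nearW => n /=; apply: gap.
have [s Ss Ms] : exists2 s, S s & (sup S - n.+1%:R^-1 < s)%R.
  by apply: sup_adherent => //; rewrite invr_gt0.
exact: lt_le_trans Ss (ccdf_nonincreasing X (ltW Ms)).
Qed.

End essential_supremum.

Section endpoint.
Context d (T : measurableType d) (R : realType) (P : probability T R).
Variables p q c : R.
Hypotheses (p1 : (1 < p)%R) (hq : q = (p / (p - 1))%R) (c1 : (1 < c)%R).
Variable X : {RV P >-> R}.
Hypothesis Xp : (X : T -> R) \in Lfun P p%:E.

Local Notation A := (upper_moment P X).

Let p0 : (0 < p)%R. Proof. exact: lt_trans ltr01 p1. Qed.
Let pB1 : (0 < p - 1)%R. Proof. by rewrite subr_gt0. Qed.
Let pB1p : (0 <= p - 1 <= p)%R. Proof. by rewrite ltW//= gerBl. Qed.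
Let pp : (0 <= p <= p)%R. Proof. by rewrite ltW/=. Qed.
Let q0 : (0 < q)%R. Proof. exact: conjugate_gt0 p1 hq. Qed.
Let cp0 : (0 < c `^ p)%R. Proof. by rewrite powR_gt0// (lt_trans ltr01 c1). Qed.

Let mtail t : measurable (X @^-1` `]t, +oo[).
Proof. by rewrite -[X in measurable X]setTI; exact: measurable_funP. Qed.

(** A nonnegative variable with zero mean vanishes almost surely, whereas
    (X - t)_+^s is positive on the event X > t. *)
Lemma upper_moment_gt0 s t : (0 < s <= p)%R -> 0 < ccdf X t -> (0 < A s t)%R.
Proof.
move=> /andP[s0 sp] Xt; rewrite lt_neqAle upper_moment_ge0 andbT eq_sym.
have ssp : (0 <= s <= p)%R by rewrite ltW.
apply/eqP => As0; move: Xt; apply/negP; rewrite -leNgt.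
have /ae_eq_integral_abs : measurable_fun [set: T]
    (fun w => ((Num.max (X w - t) 0 `^ s)%R)%:E).
  exact: (measurable_int _ (integrable_upper_moment p1 Xp t ssp)).
move=> /(_ P measurableT)[+ _]; case.
  under eq_integral do rewrite gee0_abs ?lee_fin ?powR_ge0//.
  by rewrite (upper_momentE p1 Xp)// As0.
move=> N [mN N0 sub]; rewrite -N0.
rewrite -[ccdf X t]/(P (X @^-1` `]t, +oo[)); apply: le_measure; rewrite ?inE//.
move=> w /=; rewrite in_itv/= andbT => tX; apply: sub => /= /(_ I) [] /eqP.
by rewrite powR_eq0 gt_eqF// lt_max subr_gt0 tX.
Qed.

(** As (X - t)_+^(p-1) vanishes off the event X > t, Hoelder's inequality against
    the indicator of that event gives
    A_(p-1)(t) <= A_p(t)^((p-1)/p) P(X > t)^(1/p). Together with the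
    hypothesis this forces 1 < c P(X > t)^(1/p). *)
Lemma ccdf_lower_bound t :
  (A p t `^ ((p - 1) / p) < c * A (p - 1) t)%R ->
  ((c `^ p)^-1)%:E <= ccdf X t.
Proof.
move=> H; pose E := X @^-1` `]t, +oo[%classic.
have mX : measurable_fun [set: T] X by exact: measurable_funP.
pose Z w := Num.max (X w - t)%R 0%R.
have mZ : measurable_fun [set: T] (fun w => (Z w `^ (p - 1))%R).
  apply: measurable_max0_powR.
  by apply: measurable_funB => //; exact: measurable_cst.
have ba : (q^-1 + p^-1 = 1)%R by rewrite addrC; exact: conjugateD p1 hq.
have mE : measurable_fun [set: T] (\1_E : T -> R).
  by apply: measurable_indic; exact: mtail.
have I0 w : (0 <= \1_E w :> R)%R by rewrite indicE ler0n.
have := @hoelder_ge0 _ _ _ P _ _ q p q0 p0 ba mZ mE (fun w => powR_ge0 _ _)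
  I0.
have -> : \int[P]_w (Z w `^ (p - 1) * \1_E w)%:E = (A (p - 1) t)%:E.
  rewrite -(upper_momentE p1 Xp)//; apply: eq_integral => w _; rewrite -/(Z w).
  congr EFin; rewrite indicE; case: (boolP (w \in E)) => [_|]; first by rewrite mulr1.
  rewrite notin_setE /E/= in_itv/= andbT => /negP; rewrite -leNgt => Xt.
  by rewrite mulr0 /Z (max_idPr _) ?subr_le0// powR0// gt_eqF.
have -> : \int[P]_w ((Z w `^ (p - 1)) `^ q)%:E = (A p t)%:E.
  rewrite -(upper_momentE p1 Xp)//; apply: eq_integral => w _.
  by rewrite -powRrM hq mulrC divfK// gt_eqF.
have -> : \int[P]_w (\1_E w `^ p)%:E = ccdf X t.
  rewrite -[RHS]/(P E) -[in RHS](setIT E) -integral_indic//; last exact: mtail.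
  apply: eq_integral => w _; rewrite indicE.
  by case: (_ \in _); rewrite ?powR1// powR0// gt_eqF.
have fin : ccdf X t \is a fin_num by exact: fin_num_measure.
rewrite -(fineK fin) !poweR_EFin -EFinM !lee_fin (conjugate_inv hq).
have : (0 <= fine (ccdf X t))%R by exact: fine_ge0.
move: (fine _) => x x0 AB.
set B := (A p t `^ _)%R in H AB.
have B0 : (0 <= B)%R by exact: powR_ge0.
have c0 : (0 < c)%R by exact: lt_trans c1.
have Bx : (B < B * (c * x `^ p^-1))%R.
  by rewrite (lt_le_trans H)// mulrCA ler_pM2l.
have {}B0 : (0 < B)%R.
  by rewrite lt_neqAle B0 andbT; apply: contraTneq Bx => <-; rewrite mul0r ltxx.
have cx : (1 < c * x `^ p^-1)%R by move: Bx; rewrite ltr_pMr.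
have : (1 `^ p <= (c * x `^ p^-1) `^ p)%R.
  apply: (ge0_ler_powR (ltW p0)); rewrite ?nnegrE ?(ltW cx)//.
  by rewrite (le_trans ler01) ?(ltW cx).
rewrite powR1 powRM ?powR_ge0 ?(ltW c0)// -powRrM mulVf ?gt_eqF// powRr1//.
by rewrite -ler_pdivrMl ?mulr1.
Qed.

(** Y is the indicator of X >= M divided by the probability x of that event.
    Its q-th moment is (1/x)^(q-1) <= c^(p(q-1)) = c^q. As X <= M almost surely,
    XY = MY and (X - M)_+ = 0 almost surely, so both sides are M. *)
Lemma endpoint_density_optimal M : ccdf X M = 0 ->
  ((c `^ p)^-1)%:E <= distribution P X `[M, +oo[ ->
  exists2 Y : T -> R, dual_feasible P q c Y &
    \int[P]_w (X w * Y w)%:E =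
      M%:E + c%:E * ('E_P[fun w => ((Num.max (X w - M) 0) `^ p)%R]) `^ p^-1.
Proof.
move=> XM; pose E := X @^-1` `[M, +oo[%classic.
have mE : measurable E.
  by rewrite /E -[X in measurable X]setTI; exact: measurable_funP.
have mX : measurable_fun [set: T] X by exact: measurable_funP.
have fin : P E \is a fin_num by exact: fin_num_measure.
rewrite -[distribution P X _]/(P E) -(fineK fin); set x := fine (P E).
rewrite lee_fin => cx.
have x0 : (0 < x)%R by rewrite (lt_le_trans _ cx)// invr_gt0.
pose Y w := (x^-1 * \1_E w)%R.
have mI : measurable_fun [set: T] (\1_E : T -> R) by exact: measurable_indic.
have mY : measurable_fun [set: T] Y.
  by apply: measurable_funM => //; exact: measurable_cst.
have intI k : \int[P]_w (k * \1_E w)%:E = (k * x)%:E.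
  under eq_integral do rewrite EFinM.
  rewrite integralZl//; last exact: integrable_indic.
  by rewrite integral_indic// setIT EFinM; congr (_ * _); exact/esym/fineK.
have FY : dual_feasible P q c Y.
  split => //.
  - by move=> w; rewrite mulr_ge0 ?invr_ge0 ?(ltW x0)// indicE ler0n.
  - by rewrite intI mulVf// gt_eqF.
  - have -> : \int[P]_w (Y w `^ q)%:E = \int[P]_w (x^-1 `^ q * \1_E w)%:E.
      apply: eq_integral => w _; congr EFin; rewrite /Y indicE.
      case: (_ \in _); rewrite ?mulr1// !mulr0 powR0// gt_eqF//.
    rewrite intI lee_fin -(@mulr_powRB1 _ x^-1) ?invr_ge0 ?(ltW x0)//.
    rewrite mulrAC mulVf ?gt_eqF// mul1r.
    have -> : (c `^ q = (c `^ p) `^ (q - 1))%R.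
      rewrite -powRrM; congr (_ `^ _)%R; rewrite hq.
      by field; rewrite gt_eqF.
    apply: ge0_ler_powR; rewrite ?nnegrE ?invr_ge0 ?powR_ge0 ?(ltW x0)//.
    + rewrite hq; have -> : (p / (p - 1) - 1 = (p - 1)^-1)%R by field; rewrite gt_eqF.
      by rewrite invr_ge0 ltW.
    + by rewrite -[X in (_ <= X)%R]invrK lef_pV2 ?posrE// invr_gt0.
exists Y => //.
have above w : ~ (X @^-1` `]M, +oo[) w -> (X w <= M)%R.
  by rewrite /= in_itv/= andbT => /negP; rewrite -leNgt.
have -> : \int[P]_w (X w * Y w)%:E = M%:E.
  transitivity (\int[P]_w (M * Y w)%:E).
    apply: ae_eq_integral => //.
    - exact/measurable_EFinP/measurable_funM.
    - by apply/measurable_EFinP/measurable_funM => //; exact: measurable_cst.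
    - exists (X @^-1` `]M, +oo[); split => // w /= H; apply: contrapT => /above XwM.
      apply: H => _; congr EFin; rewrite /Y indicE.
      case: (boolP (w \in E)) => [|_]; last by rewrite !mulr0.
      rewrite inE /E/= in_itv/= andbT => MX; congr (_ * _)%R.
      by apply/eqP; rewrite eq_le XwM.
  under eq_integral do rewrite /Y mulrA.
  by rewrite intI -mulrA mulVf ?gt_eqF// mulr1.
suff -> : 'E_P[fun w => ((Num.max (X w - M) 0) `^ p)%R] = 0.
  by rewrite poweR0r ?invr_eq0 ?gt_eqF// mule0 adde0.
rewrite unlock -[RHS](integral0 P setT); apply: ae_eq_integral => //.
- apply/measurable_EFinP/measurable_max0_powR.
  by apply: measurable_funB => //; exact: measurable_cst.
- exists (X @^-1` `]M, +oo[); split => // w /= H; apply: contrapT => /above XwM.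
  by apply: H => _; rewrite (max_idPr _) ?subr_le0// powR0// gt_eqF.
Qed.

(** The dichotomy is on whether some level t with P(X > t) > 0 lies on the side
    c A_(p-1)(t) <= A_p(t)^((p-1)/p) of the optimality equation. *)
Lemma exists_optimal_density : exists t, exists2 Y : T -> R,
  dual_feasible P q c Y &
    \int[P]_w (X w * Y w)%:E =
      t%:E + c%:E * ('E_P[fun w => ((Num.max (X w - t) 0) `^ p)%R]) `^ p^-1.
Proof.
have [[t [Xt cA]]|none] := pselect (exists t, 0 < ccdf X t /\
    (c * A (p - 1) t <= A p t `^ ((p - 1) / p))%R).
  have At : (0 < A (p - 1) t)%R.
    by apply: upper_moment_gt0 => //; rewrite pB1 gerBl ler01.
  have [u Au Eu] := upper_moment_crossing p1 c1 Xp At cA.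
  by exists u; exact: (power_density_optimal p1 hq c1 Xp Au Eu).
have [||M XM EM] := @ccdf_gap_atom _ _ _ P X (c `^ p)^-1%R.
- by rewrite invr_gt0.
- move=> t Xt; apply: ccdf_lower_bound; rewrite ltNge; apply/negP => cA.
  by apply: none; exists t.
by exists M; exact: endpoint_density_optimal.
Qed.

End endpoint.

(** * Duality *)

Theorem proposition6p2 (R : realType) (d : measure_display)
    (T : measurableType d) (P : probability T R) (p q c : R)
    (hp : (1 < p)%R) (hc : (1 < c)%R) (hq : q = (p / (p - 1))%R)
    (X : {RV P >-> R}) (hX : (X : T -> R) \in Lfun P p%:E) :
  higher_moment_risk P p c X = max_correlation_risk (moment_ball q c) X.
Proof.
apply/eqP; rewrite eq_le; apply/andP; split.
  have [t [Y FY XY]] := exists_optimal_density hp hq hc hX.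
  apply: (le_trans _ (dual_feasible_le_risk hp hq hX FY)); rewrite XY.
  by apply: ereal_inf_lbound; exists t.
exact: (max_correlation_risk_le hp hq (ltW (lt_trans ltr01 hc)) hX).
Qed.
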